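(* Let $G$ be a discrete group, let $(X,\pi,X/G)$ be a discrete smooth principal $G$-bundle, and let $((X\times F)/G,\pi_F,X/G)$ be an associated smooth fiber bundle, where $F$ is a smooth manifold with a smooth left action of $G$. Then the smooth cross sections $s$ of the bundle $((X\times F)/G,\pi_F,X/G)$ are in bijective correspondence with the smooth $G$-equivariant maps $\phi\colon X\to F$.
   Context: Smooth manifolds are Hausdorff and second countable. ''Discrete smooth principal $G$-bundle $(X,\pi,X/G)$'' means: $X$ is a smooth manifold with a smooth right action of the discrete group $G$ such that every $x\in X$ has a neighborhood $U$ with $U\cap U\cdot g=\emptyset$ for all $g\neq e$, and any two points with different orbits have neighborhoods whose orbits are disjoint; $\pi\colon X\to X/G$ is the quotient map, and $X/G$ carries the smooth structure for which $\pi$ is a local diffeomorphism. $G$ acts on $X\times F$ on the right by $(x,y)\cdot g=(x\cdot g,g^{-1}\cdot y)$; the orbit space $(X\times F)/G$ carries the smooth structure for which the quotient map $X\times F\to(X\times F)/G$ is a local diffeomorphism, and $\pi_F\colon (X\times F)/G\to X/G$ is given by $\pi_F((x,y)\cdot G)=\pi(x)$. A cross section is a map $s\colon X/G\to(X\times F)/G$ with $\pi_F\circ s=\mathrm{id}$. A map $\phi\colon X\to F$ is $G$-equivariant if $\phi(x\cdot g)=g^{-1}\cdot\phi(x)$ for all $x\in X$, $g\in G$. *)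

(* Defs.v *)
From HB Require Import structures.
From mathcomp Require Import all_boot all_order all_algebra.
From mathcomp Require Import generic_quotient.
From mathcomp Require Import all_classical all_reals all_analysis.

Set Implicit Arguments.
Unset Strict Implicit.
Unset Printing Implicit Defensive.
Import Order.TTheory GRing.Theory Num.Theory.
Import numFieldNormedType.Exports.
Local Open Scope classical_set_scope.
Local Open Scope ring_scope.

(* Meaningful when [U] is open: derivatives are taken in the whole space. *)
Fixpoint Ck_on (R : realType) (n m k : nat) (U : set 'rV[R]_n)
    (f : 'rV[R]_n -> 'rV[R]_m) : Prop :=
  if k is j.+1 then
    (forall x, U x -> differentiable f x) /\ (forall v, Ck_on j U ('D_v f))
  else forall x, U x -> {for x, continuous f}.

Definition Cinfty_on (R : realType) (n m : nat) (U : set 'rV[R]_n)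
    (f : 'rV[R]_n -> 'rV[R]_m) : Prop :=
  forall k, Ck_on k U f.

(* A homeomorphism from [chart_dom] onto an open subset of R^n; only the values
   of [chart_map] on [chart_dom], and of [chart_inv] on the image of
   [chart_dom], matter. *)
Record chart (R : realType) (n : nat) (T : topologicalType) := Chart {
  chart_dom : set T;
  chart_map :> T -> 'rV[R]_n;
  chart_inv : 'rV[R]_n -> T;
  chart_dom_open : open chart_dom;
  chart_im_open : open (chart_map @` chart_dom);
  chart_mapK : forall x, chart_dom x -> chart_inv (chart_map x) = x;
  chart_map_cont : forall x, chart_dom x -> {for x, continuous chart_map};
  chart_inv_cont : forall y, (chart_map @` chart_dom) y ->
    {for y, continuous chart_inv} }.

(* The atlas need not be maximal. *)
Record manifold (R : realType) (n : nat) (T : topologicalType) := Manifold {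
  atlas : set (chart R n T);
  atlas_cover : forall x, exists2 c, atlas c & chart_dom c x;
  atlas_compat : forall c d, atlas c -> atlas d ->
    Cinfty_on (c @` (chart_dom c `&` chart_dom d)) (d \o chart_inv c);
  manifold_hausdorff : hausdorff_space T;
  manifold_second_countable : @second_countable T }.

Definition smooth_on (R : realType) (n m : nat) (M N : topologicalType)
    (SM : manifold R n M) (SN : manifold R m N) (U : set M) (f : M -> N) : Prop :=
  (forall x, U x -> {for x, continuous f}) /\
  (forall c d, atlas SM c -> atlas SN d ->
     Cinfty_on (c @` (chart_dom c `&` U `&` f @^-1` chart_dom d))
               (d \o f \o chart_inv c)).

Definition smooth (R : realType) (n m : nat) (M N : topologicalType)
    (SM : manifold R n M) (SN : manifold R m N) (f : M -> N) : Prop :=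
  smooth_on SM SN setT f.

Definition local_diffeomorphism (R : realType) (n m : nat)
    (M N : topologicalType) (SM : manifold R n M) (SN : manifold R m N)
    (f : M -> N) : Prop :=
  forall x, exists U : set M, exists g : N -> M,
    [/\ open U /\ U x, open (f @` U), (forall u, U u -> g (f u) = u),
        smooth_on SM SN U f & smooth_on SN SM (f @` U) g].

Section products.
Context (R : realType).

Lemma Ck_on_lsubmx n1 n2 m k (U : set 'rV[R]_n1) (f : 'rV[R]_n1 -> 'rV[R]_m) :
  Ck_on k U f -> Ck_on k (lsubmx @^-1` U) (f \o @lsubmx R 1 n1 n2).
Proof.
elim: k f => [|k IH] f /=.
  move=> fc x Ux; apply: continuous_comp; first exact: continuous_lsubmx.
  exact: fc.
move=> [fd fv]; split=> [x Ux|v].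
  by apply: differentiable_comp; [exact: differentiable_lsubmx|exact: fd].
suff -> : 'D_v (f \o lsubmx) = ('D_(lsubmx v) f) \o @lsubmx R 1 n1 n2.
  exact: IH.
apply/funext => x; rewrite /derive.
have subE h : lsubmx (h *: v + x) = h *: lsubmx v + lsubmx x.
  by apply/rowP => j; rewrite !mxE.
by under eq_fun do rewrite /= subE.
Qed.

Lemma Ck_on_rsubmx n1 n2 m k (U : set 'rV[R]_n2) (f : 'rV[R]_n2 -> 'rV[R]_m) :
  Ck_on k U f -> Ck_on k (rsubmx @^-1` U) (f \o @rsubmx R 1 n1 n2).
Proof.
elim: k f => [|k IH] f /=.
  move=> fc x Ux; apply: continuous_comp; first exact: continuous_rsubmx.
  exact: fc.
move=> [fd fv]; split=> [x Ux|v].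
  by apply: differentiable_comp; [exact: differentiable_rsubmx|exact: fd].
suff -> : 'D_v (f \o rsubmx) = ('D_(rsubmx v) f) \o @rsubmx R 1 n1 n2.
  exact: IH.
apply/funext => x; rewrite /derive.
have subE h : rsubmx (h *: v + x) = h *: rsubmx v + rsubmx x.
  by apply/rowP => j; rewrite !mxE.
by under eq_fun do rewrite /= subE.
Qed.

Lemma Ck_on_subset n m k (U V : set 'rV[R]_n) (f : 'rV[R]_n -> 'rV[R]_m) :
  U `<=` V -> Ck_on k V f -> Ck_on k U f.
Proof.
move=> UV; elim: k f => [|k IH] f /=; first by move=> fc x /UV; exact: fc.
by move=> [fd fv]; split=> [x /UV/fd//|v]; exact: IH.
Qed.

Lemma near_eq_differentiable n m (f g : 'rV[R]_n -> 'rV[R]_m) x :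
  (\near x, f x = g x) -> differentiable f x -> differentiable g x.
Proof.
move=> fg /diff_locallyP[dc /eqaddoP de].
suff E : g \o shift x = cst (g x) + 'd f x +o_ 0 id.
  have dE := diff_unique dc E.
  by apply/diff_locallyP; rewrite dE; split.
apply/eqaddoP => e /de.
have fg' : \forall h \near (0 : 'rV[R]_n), f (h + x) = g (h + x).
  by rewrite (near_shift x 0); near=> h; rewrite /= sub0r subrK; near: h.
have fgx : f x = g x := nbhs_singleton fg.
apply: filter_app; near=> h; rewrite !fctE /= fgx.
by have -> : f (h + x) = g (h + x) by near: h.
Unshelve. all: by end_near. Qed.

Lemma Ck_on_eq n m k (U : set 'rV[R]_n) (f g : 'rV[R]_n -> 'rV[R]_m) :
  open U -> (forall x, U x -> f x = g x) -> Ck_on k U f -> Ck_on k U g.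
Proof.
move=> oU; elim: k f g => [|k IH] f g fg.
  move=> fc x Ux A nA.
  have fA : nbhs (f x) A by rewrite fg.
  have fxA : nbhs x (f @^-1` A) := fc x Ux A fA.
  have nU := open_nbhs_nbhs (conj oU Ux).
  have : nbhs x (U `&` f @^-1` A) by exact: filterI.
  by apply: (@filterS _ (nbhs x)) => y [Uy /=]; rewrite fg.
have fgn x : U x -> \near x, f x = g x.
  by move=> Ux; have nU := open_nbhs_nbhs (conj oU Ux); apply: filterS nU.
move=> [fd fv]; split=> [x Ux|v].
  exact: near_eq_differentiable (fgn x Ux) (fd x Ux).
by apply: IH (fv v) => x Ux; apply: near_eq_derive; exact: fgn.
Qed.

Lemma row_mx_continuous n1 n2 :
  continuous (fun p : 'rV[R]_n1 * 'rV[R]_n2 => row_mx p.1 p.2).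
Proof.
move=> p A [P nP PA].
have nQ : nbhs p [set q : 'rV[R]_n1 * 'rV[R]_n2 | forall i j, P i j (row_mx q.1 q.2 i j)].
  apply: (@filter_forall _ _ _ (nbhs p)) => i.
  apply: (@filter_forall _ _ _ (nbhs p)) => j.
  have := nP i j; rewrite mxE; case E: (fintype.split j) => [k|k] nPij.
    have n1P : nbhs p.1 [set u : 'rV[R]_n1 | P i j (u i k)].
      exact: coord_continuous nPij.
    have n2P : nbhs p [set q : 'rV[R]_n1 * 'rV[R]_n2 | P i j (q.1 i k)] by exact: cvg_fst n1P.
    by apply: filterS n2P => q; rewrite /= mxE E.
  have n1P : nbhs p.2 [set u : 'rV[R]_n2 | P i j (u i k)].
    exact: coord_continuous nPij.
  have n2P : nbhs p [set q : 'rV[R]_n1 * 'rV[R]_n2 | P i j (q.2 i k)] by exact: cvg_snd n1P.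
  by apply: filterS n2P => q; rewrite /= mxE E.
by apply: filterS nQ => q; exact: PA.
Qed.

Lemma pair_continuous (T V W : topologicalType) (f : T -> V) (g : T -> W) x :
  {for x, continuous f} -> {for x, continuous g} ->
  {for x, continuous (fun y => (f y, g y))}.
Proof. by move=> fc gc; exact: cvg_pair fc gc. Qed.

Lemma continuous_row_mx (T : topologicalType) n1 n2 (f : T -> 'rV[R]_n1)
    (g : T -> 'rV[R]_n2) x :
  {for x, continuous f} -> {for x, continuous g} ->
  {for x, continuous (fun y => row_mx (f y) (g y))}.
Proof.
move=> fc gc; have fgc := pair_continuous fc gc.
exact: (continuous_comp fgc (@row_mx_continuous _ _ _)).
Qed.

Lemma differentiable_row_mx n n1 n2 (f : 'rV[R]_n -> 'rV[R]_n1)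
    (g : 'rV[R]_n -> 'rV[R]_n2) x :
  differentiable f x -> differentiable g x ->
  differentiable (fun y => row_mx (f y) (g y)) x.
Proof.
move=> df dg.
have lA : linear (fun u : 'rV[R]_n1 => row_mx u (0 : 'rV[R]_n2)).
  by move=> a u v; rewrite scale_row_mx add_row_mx scaler0 addr0.
have lB : linear (fun u : 'rV[R]_n2 => row_mx (0 : 'rV[R]_n1) u).
  by move=> a u v; rewrite scale_row_mx add_row_mx scaler0 addr0.
pose A : {linear 'rV[R]_n1 -> 'rV[R]_(n1 + n2)} :=
  HB.pack (fun u : 'rV[R]_n1 => row_mx u (0 : 'rV[R]_n2))
    (GRing.isLinear.Build _ _ _ _ _ lA).
pose B : {linear 'rV[R]_n2 -> 'rV[R]_(n1 + n2)} :=
  HB.pack (fun u : 'rV[R]_n2 => row_mx (0 : 'rV[R]_n1) u)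
    (GRing.isLinear.Build _ _ _ _ _ lB).
have -> : (fun y => row_mx (f y) (g y)) = (A \o f) + (B \o g).
  by apply/funext => y; rewrite fctE/= add_row_mx addr0 add0r.
have cA : continuous (fun u : 'rV[R]_n1 => row_mx u (0 : 'rV[R]_n2)).
  by move=> u; apply: (@continuous_row_mx _ _ _ id (cst 0) u);
    [by []|exact: cst_continuous].
have cB : continuous (fun u : 'rV[R]_n2 => row_mx (0 : 'rV[R]_n1) u).
  by move=> u; apply: (@continuous_row_mx _ _ _ (cst 0) id u);
    [exact: cst_continuous|by []].
apply: differentiableD; apply: differentiable_comp => //.
  exact: (@linear_differentiable _ _ _ A).
exact: (@linear_differentiable _ _ _ B).
Qed.

Lemma Ck_on_row_mx n n1 n2 k (U : set 'rV[R]_n) (f : 'rV[R]_n -> 'rV[R]_n1)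
    (g : 'rV[R]_n -> 'rV[R]_n2) : open U ->
  Ck_on k U f -> Ck_on k U g -> Ck_on k U (fun y => row_mx (f y) (g y)).
Proof.
move=> oU; elim: k f g => [|k IH] f g /=.
  move=> fc gc x Ux.
  by apply: continuous_row_mx; [exact: fc|exact: gc].
move=> [fd fv] [gd gv]; split=> [x Ux|v].
  by apply: differentiable_row_mx; [exact: fd|exact: gd].
apply: Ck_on_eq oU _ (IH _ _ (fv v) (gv v)) => x Ux.
have dfv : derivable f x v by exact: diff_derivable (fd x Ux).
have dgv : derivable g x v by exact: diff_derivable (gd x Ux).
have dfgv : derivable (fun y => row_mx (f y) (g y)) x v.
  exact: diff_derivable (differentiable_row_mx (fd x Ux) (gd x Ux)).
rewrite (derive_mx dfv) (derive_mx dgv) (derive_mx dfgv).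
apply/matrixP => i j; rewrite !mxE.
by case E: (fintype.split j) => [h|h]; rewrite !mxE; congr ('D_v _ x);
  apply/funext => y; rewrite !mxE E.
Qed.

Lemma open_setX (M N : topologicalType) (U : set M) (V : set N) :
  open U -> open V -> open (U `*` V).
Proof.
move=> oU oV; rewrite (_ : _ `*` _ = fst @^-1` U `&` snd @^-1` V)//.
apply: openI; apply: open_comp => // ? _; [exact: cvg_fst|exact: cvg_snd].
Qed.

Lemma chart_im_open_sub n (M : topologicalType) (c : chart R n M) (U : set M) :
  open U -> open (c @` (chart_dom c `&` U)).
Proof.
move=> oU; rewrite openE => _ [x [cx Ux] <-].
have nx : nbhs (c x) (c @` chart_dom c).
  by apply: open_nbhs_nbhs; split; [exact: chart_im_open|exists x].
have cxim : (c @` chart_dom c) (c x) by exists x.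
have nU : nbhs (c x) (chart_inv c @^-1` U).
  apply: (chart_inv_cont cxim); rewrite chart_mapK//.
  exact: open_nbhs_nbhs.
have : nbhs (c x) (c @` chart_dom c `&` chart_inv c @^-1` U) by exact: filterI.
apply: filterS => _ [[y cy <-]] /=; rewrite chart_mapK// => Uy.
by exists y.
Qed.

Section product_chart.
Context (n m : nat) (M N : topologicalType) (c : chart R n M) (d : chart R m N).

Let dom := chart_dom c `*` chart_dom d.
Let map (p : M * N) := row_mx (c p.1) (d p.2).
Let inv (v : 'rV[R]_(n + m)) := (chart_inv c (lsubmx v), chart_inv d (rsubmx v)).

Let im_mapE : map @` dom =
  lsubmx @^-1` (c @` chart_dom c) `&` rsubmx @^-1` (d @` chart_dom d).
Proof.
apply/seteqP; split=> [_ [p [p1 p2] <-]|v [[x cx xv] [y dy yv]]].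
  by rewrite /map; split=> /=; rewrite ?row_mxKl ?row_mxKr;
    [exists p.1|exists p.2].
by exists (x, y); rewrite // /map/= xv yv hsubmxK.
Qed.

Let dom_open : open dom.
Proof. by apply: open_setX; exact: chart_dom_open. Qed.

Let im_open : open (map @` dom).
Proof.
rewrite im_mapE; apply: openI; apply: open_comp => [v _|].
- exact: continuous_lsubmx.
- exact: chart_im_open.
- exact: continuous_rsubmx.
- exact: chart_im_open.
Qed.

Let mapK p : dom p -> inv (map p) = p.
Proof.
case: p => x y [/= cx dy].
by rewrite /inv /map/= row_mxKl row_mxKr !chart_mapK.
Qed.

Let map_cont p : dom p -> {for p, continuous map}.
Proof.
move=> [p1 p2]; apply: continuous_row_mx.
  exact: (continuous_comp cvg_fst (chart_map_cont p1)).
exact: (continuous_comp cvg_snd (chart_map_cont p2)).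
Qed.

Let inv_cont v : (map @` dom) v -> {for v, continuous inv}.
Proof.
rewrite im_mapE => -[v1 v2].
have ic : {for v, continuous (chart_inv c \o @lsubmx R 1 n m)}.
  apply: continuous_comp; first exact: continuous_lsubmx.
  exact: chart_inv_cont.
have id : {for v, continuous (chart_inv d \o @rsubmx R 1 n m)}.
  apply: continuous_comp; first exact: continuous_rsubmx.
  exact: chart_inv_cont.
exact: pair_continuous ic id.
Qed.

Definition product_chart : chart R (n + m) (M * N)%type :=
  Chart dom_open im_open mapK map_cont inv_cont.

End product_chart.

Section product_manifold.
Context (n m : nat) (M N : topologicalType).
Context (SM : manifold R n M) (SN : manifold R m N).

Let product_atlas : set (chart R (n + m) (M * N)%type) :=
  [set product_chart c d | c in atlas SM & d in atlas SN].

Let product_cover p : exists2 c, product_atlas c & chart_dom c p.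
Proof.
have [c cA cp] := atlas_cover SM p.1; have [d dA dp] := atlas_cover SN p.2.
by exists (product_chart c d) => //; exists c => //; exists d.
Qed.

Let product_compat c d : product_atlas c -> product_atlas d ->
  Cinfty_on (c @` (chart_dom c `&` chart_dom d)) (d \o chart_inv c).
Proof.
move=> [c1 c1A [c2 c2A <-]] [d1 d1A [d2 d2A <-]] k.
have c1d1 := @Ck_on_lsubmx n m _ k _ _ (atlas_compat c1A d1A k).
have c2d2 := @Ck_on_rsubmx n m _ k _ _ (atlas_compat c2A d2A k).
set A1 := c1 @` (chart_dom c1 `&` chart_dom d1).
set A2 := c2 @` (chart_dom c2 `&` chart_dom d2).
set A := _ @` _.
have A1s : A `<=` lsubmx @^-1` A1.
  move=> _ [p [[p1 p2] [p3 p4]] <-]; exists p.1 => //=.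
  by rewrite row_mxKl.
have A2s : A `<=` rsubmx @^-1` A2.
  move=> _ [p [[p1 p2] [p3 p4]] <-]; exists p.2 => //=.
  by rewrite row_mxKr.
apply: Ck_on_row_mx; last 2 first.
- exact: Ck_on_subset A1s c1d1.
- exact: Ck_on_subset A2s c2d2.
by apply: chart_im_open_sub; apply: open_setX; exact: chart_dom_open.
Qed.

Let product_hausdorff : hausdorff_space (M * N)%type.
Proof.
move=> p q pq; have [p1 p2] : cluster (nbhs p.1) q.1 /\ cluster (nbhs p.2) q.2.
  split=> A B nA nB.
    have nA' : nbhs p [set r : M * N | A r.1] by exact: cvg_fst nA.
    have nB' : nbhs q [set r : M * N | B r.1] by exact: cvg_fst nB.
    by have [r [rA rB]] := pq _ _ nA' nB'; exists r.1.
  have nA' : nbhs p [set r : M * N | A r.2] by exact: cvg_snd nA.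
  have nB' : nbhs q [set r : M * N | B r.2] by exact: cvg_snd nB.
  by have [r [rA rB]] := pq _ _ nA' nB'; exists r.2.
rewrite [p]surjective_pairing [q]surjective_pairing.
by rewrite (manifold_hausdorff SM p1) (manifold_hausdorff SN p2).
Qed.

Let product_second_countable : @second_countable (M * N)%type.
Proof.
have [B cB [oB bB]] := manifold_second_countable SM.
have [C cC [oC bC]] := manifold_second_countable SN.
exists [set BC.1 `*` BC.2 | BC in B `*` C].
  by apply: sub_countable (card_image_le _ _) _; exact: countableX.
split=> [_ [[U V] [/= BU CV] <-]|p A [[U V] [/= nU nV] UVA]].
  exact: open_setX (oB _ BU) (oC _ CV).
have [U' [BU' U'p] U'U] := bB _ _ nU; have [V' [CV' V'p] V'V] := bC _ _ nV.
exists (U' `*` V'); first by split; [exists (U', V')|].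
by move=> r [/= /U'U rU /V'V rV]; exact: UVA.
Qed.

Definition product_manifold : manifold R (n + m) (M * N)%type :=
  Manifold product_cover product_compat product_hausdorff
    product_second_countable.

End product_manifold.
End products.

Section actions.
Local Open Scope group_scope.

(* [G] carries no topology: it is discrete, so an action of [G] is smooth iff
   each group element acts by a smooth map. *)
Record right_action (G : groupType) (X : Type) := RightAction {
  ract :> X -> G -> X;
  ract1 : forall x, ract x 1 = x;
  ractM : forall x g h, ract x (g * h) = ract (ract x g) h }.

Record left_action (G : groupType) (F : Type) := LeftAction {
  lact :> G -> F -> F;
  lact1 : forall y, lact 1 y = y;
  lactM : forall g h y, lact (g * h) y = lact g (lact h y) }.

Definition diag_fun (G : groupType) (X F : Type) (a : right_action G X)
    (b : left_action G F) (p : X * F) (g : G) : X * F :=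
  (a p.1 g, b g^-1 p.2).

Lemma diag_fun1 (G : groupType) (X F : Type) (a : right_action G X)
    (b : left_action G F) p : diag_fun a b p 1 = p.
Proof. by case: p => x y; rewrite /diag_fun/= invg1 ract1 lact1. Qed.

Lemma diag_funM (G : groupType) (X F : Type) (a : right_action G X)
    (b : left_action G F) p g h :
  diag_fun a b p (g * h) = diag_fun a b (diag_fun a b p g) h.
Proof. by case: p => x y; rewrite /diag_fun/= invgM ractM lactM. Qed.

Definition diag_action (G : groupType) (X F : Type) (a : right_action G X)
    (b : left_action G F) : right_action G (X * F)%type :=
  RightAction (diag_fun1 a b) (diag_funM a b).

Section orbits.
Local Open Scope quotient_scope.
Context (G : groupType) (X : topologicalType) (a : right_action G X).

Definition orbit_rel : rel X := fun x y => `[< exists g, y = a x g >].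

Lemma orbit_rel_refl : reflexive orbit_rel.
Proof. by move=> x; apply/asboolP; exists 1; rewrite ract1. Qed.

Lemma orbit_rel_sym : symmetric orbit_rel.
Proof.
move=> x y; apply: asbool_equiv_eq.
by split=> -[g ->]; exists g^-1; rewrite -ractM mulgV ract1.
Qed.

Lemma orbit_rel_trans : transitive orbit_rel.
Proof.
move=> y x z /asboolP[g ->] /asboolP[h ->].
by apply/asboolP; exists (g * h); rewrite ractM.
Qed.

Definition orbit_equiv : equiv_rel X :=
  EquivRel orbit_rel orbit_rel_refl orbit_rel_sym orbit_rel_trans.

Definition orbit_space : topologicalType :=
  quotient_topology {eq_quot orbit_equiv}.

Definition orbit_proj (x : X) : orbit_space := \pi_{eq_quot orbit_equiv} x.

Lemma orbit_projP x y : orbit_proj x = orbit_proj y <-> exists g, y = a x g.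
Proof.
split=> [/eqquotP/asboolP //|xy].
by apply/eqquotP/asboolP.
Qed.

End orbits.
End actions.

Section bundles.
Local Open Scope group_scope.
Context (R : realType) (G : groupType).

Record principal_bundle (n : nat) (X : topologicalType)
    (SX : manifold R n X) := PrincipalBundle {
  pb_act : right_action G X;
  pb_act_smooth : forall g, smooth SX SX (pb_act^~ g);
  pb_act_free : forall x : X, exists2 U : set X, nbhs x U &
    forall g, g != 1 -> U `&` [set pb_act u g | u in U] = set0;
  pb_act_separated : forall x y : X, orbit_proj pb_act x <> orbit_proj pb_act y ->
    exists U V : set X, [/\ nbhs x U, nbhs y V &
      [set pb_act u g | u in U & g in [set: G]] `&`
      [set pb_act v g | v in V & g in [set: G]] = set0];
  pb_base : manifold R n (orbit_space pb_act);
  pb_proj_local_diffeo : local_diffeomorphism SX pb_base (orbit_proj pb_act) }.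

Record associated_bundle (n m : nat) (X F : topologicalType)
    (SX : manifold R n X) (SF : manifold R m F)
    (P : principal_bundle SX) := AssociatedBundle {
  ab_act : left_action G F;
  ab_act_smooth : forall g, smooth SF SF (ab_act g);
  ab_total : manifold R (n + m) (orbit_space (diag_action (pb_act P) ab_act));
  ab_proj_local_diffeo : local_diffeomorphism (product_manifold SX SF) ab_total
    (orbit_proj (diag_action (pb_act P) ab_act)) }.

Section associated.
Context (n m : nat) (X F : topologicalType).
Context (SX : manifold R n X) (SF : manifold R m F).
Context (P : principal_bundle SX) (E : associated_bundle SF P).

Definition base_space := orbit_space (pb_act P).
Definition base_proj : X -> base_space := orbit_proj (pb_act P).

Definition total_space := orbit_space (diag_action (pb_act P) (ab_act E)).
Definition total_proj : X * F -> total_space :=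
  orbit_proj (diag_action (pb_act P) (ab_act E)).

(* The value does not depend on the representative, see [bundle_projE]. *)
Definition bundle_proj (e : total_space) : base_space :=
  base_proj (repr e).1.

Lemma bundle_projE x y : bundle_proj (total_proj (x, y)) = base_proj x.
Proof.
apply/esym/orbit_projP.
have [g] : exists g, repr (total_proj (x, y)) =
    diag_action (pb_act P) (ab_act E) (x, y) g.
  by apply/orbit_projP; rewrite /orbit_proj reprK.
by move=> e; exists g; rewrite e.
Qed.

Definition cross_section (s : base_space -> total_space) : Prop :=
  forall b, bundle_proj (s b) = b.

Definition smooth_cross_sections : set (base_space -> total_space) :=
  [set s | smooth (pb_base P) (ab_total E) s /\ cross_section s].

Definition equivariant (phi : X -> F) : Prop :=
  forall x g, phi (pb_act P x g) = ab_act E g^-1 (phi x).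

Definition smooth_equivariant_maps : set (X -> F) :=
  [set phi | smooth SX SF phi /\ equivariant phi].

End associated.
End bundles.

Arguments base_proj {R G n X SX} P x.
Arguments total_proj {R G n m X F SX SF P} E p.
Arguments bundle_proj {R G n m X F SX SF P} E e.
Arguments cross_section {R G n m X F SX SF P} E s.
Arguments smooth_cross_sections {R G n m X F SX SF P} E s.
Arguments equivariant {R G n m X F SX SF P} E phi.
Arguments smooth_equivariant_maps {R G n m X F SX SF P} E phi.

(* Main.v *)
(** A section [s] and an equivariant map [phi] correspond when
    [s (pi x) = q (x, phi x)], where [q] is the quotient map of [X * F]: since
    [G] acts freely on [X], every point of the fibre over [pi x] is [q (x, y)]
    for exactly one [y]. Near a point, [s] is [q \o (id, phi)] composed with a
    local inverse of [pi], while [phi] is the second component of a local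
    inverse of [q] composed with [s \o pi], so each is smooth when the other
    is. *)

Require Import Defs.
From mathcomp Require Import all_boot all_order all_algebra.
From mathcomp Require Import all_classical all_reals all_analysis.
Local Open Scope classical_set_scope.
Import GRing.Theory.
Import numFieldNormedType.Exports.
Local Open Scope ring_scope.
Set Implicit Arguments.
Unset Strict Implicit.
Unset Printing Implicit Defensive.

(** * Calculus of [Ck_on] maps: sums, products with a coordinate, and composition *)

Section Ck.
Context {R : realType}.

Lemma Ck_on_pred n m k (U : set 'rV[R]_n) (f : 'rV[R]_n -> 'rV[R]_m) :
  Ck_on k.+1 U f -> Ck_on k U f.
Proof.
elim: k f => [|k IH] f.
  by move=> [fd _] x Ux; exact: differentiable_continuous (fd x Ux).
by move=> [fd fv]; split=> // v; apply: IH; exact: fv.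
Qed.

(** Each clause of [Ck_on] is a condition at a single point on derivatives taken in the whole space,
    so sets [W] that merely contain the points suffice. *)
Lemma Ck_on_local n m k (U : set 'rV[R]_n) (f : 'rV[R]_n -> 'rV[R]_m) :
  (forall x, U x -> exists2 W, W x & Ck_on k W f) -> Ck_on k U f.
Proof.
elim: k f => [|k IH] f /= fW; first by move=> x /fW[W Wx]; exact.
split=> [x /fW[W Wx [fd _]]|v]; first exact: fd.
by apply: IH => x /fW[W Wx [_ fv]]; exists W.
Qed.

Lemma Ck_on_cst n m k (U : set 'rV[R]_n) (a : 'rV[R]_m) :
  Ck_on k U (fun=> a).
Proof.
elim: k a => [|k IH] a /=; first by move=> x _; exact: cst_continuous.
split=> [x _|v]; first exact: differentiable_cst.
by have -> : 'D_v (fun=> a) = fun=> 0 by apply/funext => x; exact: derive_cst.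
Qed.

Lemma Ck_on_add n m k (U : set 'rV[R]_n) (f g : 'rV[R]_n -> 'rV[R]_m) :
  open U -> Ck_on k U f -> Ck_on k U g -> Ck_on k U (f + g).
Proof.
move=> oU; elim: k f g => [|k IH] f g /=.
  by move=> fc gc x Ux; apply: continuousD; [exact: fc|exact: gc].
move=> [fd fv] [gd gv]; split=> [x Ux|v].
  by apply: differentiableD; [exact: fd|exact: gd].
apply: (Ck_on_eq oU _ (IH _ _ (fv v) (gv v))) => x Ux.
by rewrite deriveD//; apply: diff_derivable; [exact: fd|exact: gd].
Qed.

Lemma Ck_on_sum n m k p (U : set 'rV[R]_n)
    (f : 'I_p -> 'rV[R]_n -> 'rV[R]_m) :
  open U -> (forall i, Ck_on k U (f i)) -> Ck_on k U (\sum_i f i).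
Proof.
move=> oU fC; elim/big_ind : _ => //; first exact: Ck_on_cst.
by move=> g h; exact: Ck_on_add.
Qed.

Lemma coord_differentiable n m (h : 'rV[R]_n -> 'rV[R]_m) i x :
  differentiable h x -> differentiable (fun y => h y 0 i) x.
Proof.
move=> hd.
apply: (@differentiable_comp _ _ _ _ h (fun u : 'rV[R]_m => u 0 i)) => //.
exact: differentiable_coord.
Qed.

(** Such products are the summands of the chain rule [derive_comp], where [h] is a directional
    derivative. Expanding [f y] in the standard basis reduces the claim to products of scalar
    functions. *)
Lemma coord_scale_differentiable n m p (h : 'rV[R]_n -> 'rV[R]_p) i
    (f : 'rV[R]_n -> 'rV[R]_m) x :
  differentiable h x -> differentiable f x ->
  differentiable (fun y => h y 0 i *: f y) x.
Proof.
move=> hd fd.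
have -> : (fun y => h y 0 i *: f y) =
    \sum_(j < m) (fun y => (h y 0 i * f y 0 j) *: (delta_mx 0 j : 'rV[R]_m)).
  apply/funext => y; rewrite fct_sumE [f y in LHS]row_sum_delta scaler_sumr.
  by apply: eq_bigr => j _; rewrite scalerA.
apply: (@differentiable_sum _ _ _ _
  (fun j y => (h y 0 i * f y 0 j) *: (delta_mx 0 j : 'rV[R]_m))) => j.
apply: differentiableZl.
apply: (@differentiableM _ _ (fun y => h y 0 i) (fun y => f y 0 j)).
  exact: coord_differentiable.
exact: coord_differentiable.
Qed.

Lemma coord_scale_derive n m p (h : 'rV[R]_n -> 'rV[R]_p) i
    (f : 'rV[R]_n -> 'rV[R]_m) x v :
  differentiable h x -> differentiable f x ->
  'D_v (fun y => h y 0 i *: f y) x =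
    'D_v h x 0 i *: f x + h x 0 i *: 'D_v f x.
Proof.
move=> hd fd.
have hv : derivable h x v by exact: diff_derivable.
have fv : derivable f x v by exact: diff_derivable.
have hfv : derivable (fun y => h y 0 i *: f y) x v.
  by apply: diff_derivable; exact: coord_scale_differentiable.
rewrite (derive_mx hfv) (derive_mx hv) (derive_mx fv).
apply/rowP => j; rewrite !mxE.
under [in LHS]eq_fun do rewrite mxE.
rewrite (@deriveM _ _ (fun y => h y 0 i) (fun y => f y 0 j)).
- by rewrite addrC; congr (_ + _); rewrite mulrC.
- by apply: diff_derivable; exact: coord_differentiable.
- by apply: diff_derivable; exact: coord_differentiable.
Qed.

Lemma Ck_on_coord_scale n m p k (U : set 'rV[R]_n) (h : 'rV[R]_n -> 'rV[R]_p) i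
    (f : 'rV[R]_n -> 'rV[R]_m) :
  open U -> Ck_on k U h -> Ck_on k U f -> Ck_on k U (fun y => h y 0 i *: f y).
Proof.
move=> oU; elim: k h f => [|k IH] h f.
  move=> hc fc x Ux; apply: continuousZ (fc x Ux).
  apply: (@continuous_comp _ _ _ h (fun u : 'rV[R]_p => u 0 i)); first exact: hc.
  exact: coord_continuous.
move=> hC fC; have [hd hv] := hC; have [fd fv] := fC.
split=> [x Ux|v].
  by apply: coord_scale_differentiable; [exact: hd|exact: fd].
(* In each Leibniz term the undifferentiated factor is lowered by one order, so that the induction
   hypothesis applies to both factors. *)
apply: (Ck_on_eq oU _ (Ck_on_add oU (IH _ _ (hv v) (Ck_on_pred fC))
  (IH _ _ (Ck_on_pred hC) (fv v)))) => x Ux.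
by rewrite coord_scale_derive//; [exact: hd|exact: fd].
Qed.

(** The chain rule is expanded along fixed basis directions because [Ck_on] controls ['D_v g] only
    for constant [v], whereas the direction ['D_v f x] varies with [x]. *)
Lemma derive_comp n m p (f : 'rV[R]_n -> 'rV[R]_m) (g : 'rV[R]_m -> 'rV[R]_p)
    x v : differentiable f x -> differentiable g (f x) ->
  'D_v (g \o f) x = \sum_j 'D_v f x 0 j *: 'D_(delta_mx 0 j) g (f x).
Proof.
move=> fd gd.
rewrite deriveE; last exact: differentiable_comp.
rewrite diff_comp//= -(deriveE v fd) [in LHS](row_sum_delta ('D_v f x)).
rewrite linear_sum.
by apply: eq_bigr => j _; rewrite linearZ/= (deriveE _ gd).
Qed.

Lemma Ck_on_comp n m p k (U : set 'rV[R]_n) (V : set 'rV[R]_m)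
    (f : 'rV[R]_n -> 'rV[R]_m) (g : 'rV[R]_m -> 'rV[R]_p) :
  open U -> (forall x, U x -> V (f x)) ->
  Ck_on k U f -> Ck_on k V g -> Ck_on k U (g \o f).
Proof.
move=> oU fUV; elim: k g => [|k IH] g.
  by move=> fc gc x Ux; apply: continuous_comp; [exact: fc|exact/gc/fUV].
move=> fC; have [fd fv] := fC; move=> [gd gv].
split=> [x Ux|v]; first by apply: differentiable_comp; [exact: fd|exact/gd/fUV].
have sC : Ck_on k U
    (\sum_j (fun x => 'D_v f x 0 j *: ('D_(delta_mx 0 j) g \o f) x)).
  apply: Ck_on_sum => // j; apply: Ck_on_coord_scale => //.
    exact: fv.
  by apply: IH; [exact: Ck_on_pred|exact: gv].
apply: (Ck_on_eq oU _ sC) => x Ux.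
by rewrite fct_sumE derive_comp//; [exact: fd|exact/gd/fUV].
Qed.

End Ck.

(** * Smooth maps between manifolds, treated locally *)

Lemma open_setI_preimage (M N : topologicalType) (U : set M) (V : set N)
    (f : M -> N) : open U -> (forall x, U x -> {for x, continuous f}) ->
  open V -> open (U `&` f @^-1` V).
Proof.
move=> oU fc oV; rewrite openE => x [Ux Vfx].
apply: filterI; first exact: open_nbhs_nbhs.
by apply: (fc x Ux); exact: open_nbhs_nbhs.
Qed.

Section smooth_maps.
Context {R : realType}.

Section smooth_on_lemmas.
Context {n m : nat} {M N : topologicalType}.
Context (SM : manifold R n M) (SN : manifold R m N).
Implicit Types (U : set M) (f g : M -> N).

Lemma smooth_on_subset U V f :
  U `<=` V -> smooth_on SM SN V f -> smooth_on SM SN U f.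
Proof.
move=> UV [fc fC]; split=> [x /UV|c d cA dA k]; first exact: fc.
apply: Ck_on_subset (fC c d cA dA k).
by move=> _ [x [[cx Ux] dfx] <-]; exists x => //; split=> //; split=> //; exact: UV.
Qed.

Lemma smooth_on_eq U f g : open U -> (forall x, U x -> f x = g x) ->
  smooth_on SM SN U f -> smooth_on SM SN U g.
Proof.
move=> oU fg [fc fC]; split=> [x Ux A nA|c d cA dA k].
  have : nbhs x (U `&` f @^-1` A).
    apply: filterI; first exact: open_nbhs_nbhs.
    by apply: (fc x Ux); rewrite /= fg.
  by apply: (@filterS _ (nbhs x)) => y [Uy /=]; rewrite fg.
have -> : chart_dom c `&` U `&` g @^-1` chart_dom d =
    chart_dom c `&` U `&` f @^-1` chart_dom d.
  by apply/seteqP; split=> x [[cx Ux]] /= dx; split=> //=; move: dx; rewrite fg.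
apply: Ck_on_eq (fC c d cA dA k); last first.
  by move=> _ [x [[cx Ux] dfx] <-]; rewrite /= chart_mapK// fg.
rewrite -setIA; apply: chart_im_open_sub.
exact: open_setI_preimage (chart_dom_open d).
Qed.

(** Local inverses are smooth only near a point; this germ-like notion lets them be composed. *)
Definition smooth_at x f : Prop :=
  exists U, [/\ open U, U x & smooth_on SM SN U f].

Lemma smooth_atP f : smooth SM SN f <-> forall x, smooth_at x f.
Proof.
split=> [fC x|fC]; first by exists setT; split=> //; exact: openT.
split=> [x _|c d cA dA k]; first by have [U [_ Ux [fc _]]] := fC x; exact: fc.
apply: Ck_on_local => _ [x [[cx _] dfx] <-].
have [U [_ Ux [_ UC]]] := fC x.
by exists (c @` (chart_dom c `&` U `&` f @^-1` chart_dom d)); [exists x|exact: UC].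
Qed.

Lemma smooth_at_near_eq x f g :
  (\near x, f x = g x) -> smooth_at x f -> smooth_at x g.
Proof.
rewrite /prop_near1 nbhsE => -[V [oV Vx] fg] [U [oU Ux fC]].
exists (U `&` V); split=> //; first exact: openI.
apply: (smooth_on_eq (f := f)); first exact: openI.
  by move=> y [_ /fg].
exact: smooth_on_subset fC.
Qed.

Lemma smooth_at_continuous x f : smooth_at x f -> {for x, continuous f}.
Proof. by move=> [U [_ Ux [fc _]]]; exact: fc. Qed.

End smooth_on_lemmas.

Lemma smooth_at_comp n m p (M N K : topologicalType) (SM : manifold R n M)
    (SN : manifold R m N) (SK : manifold R p K) (f : M -> N) (g : N -> K) x :
  smooth_at SM SN x f -> smooth_at SN SK (f x) g -> smooth_at SM SK x (g \o f).
Proof.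
move=> [U [oU Ux [fc fC]]] [V [oV Vfx [gc gC]]].
exists (U `&` f @^-1` V); split=> //; first exact: open_setI_preimage.
split=> [y [Uy Vfy]|c e cA eA k].
  by apply: continuous_comp; [exact: fc|exact: gc].
apply: Ck_on_local => _ [y [[cy [Uy Vfy]] egfy] <-].
have [d dA dfy] := atlas_cover SN (f y).
pose W := V `&` g @^-1` chart_dom e.
have oW : open W by exact: open_setI_preimage (chart_dom_open e).
(* On [Y] the coordinate expression of [g \o f] factors through the intermediate chart [d], so
   [Ck_on_comp] applies. *)
pose Y := U `&` f @^-1` (chart_dom d `&` W).
have oY : open Y.
  by apply: open_setI_preimage => //; apply: openI => //; exact: chart_dom_open.
have oA : open (c @` (chart_dom c `&` Y)) by exact: chart_im_open_sub.
exists (c @` (chart_dom c `&` Y)); first by exists y.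
have gfC : Ck_on k (c @` (chart_dom c `&` Y))
    ((e \o g \o chart_inv d) \o (d \o f \o chart_inv c)).
  apply: (Ck_on_comp oA _ _ (gC d e dA eA k)).
    move=> _ [z [cz [Uz [dfz [Vfz egfz]]]] <-] /=; rewrite chart_mapK//.
    by exists (f z).
  apply: Ck_on_subset (fC c d cA dA k).
  by move=> _ [z [cz [Uz [dfz _]]] <-]; exists z.
apply: (Ck_on_eq oA _ gfC) => _ [z [cz [Uz [dfz _]]] <-].
by rewrite /= chart_mapK// chart_mapK.
Qed.

Lemma smooth_id n (M : topologicalType) (SM : manifold R n M) : smooth SM SM id.
Proof.
split=> [x _|c d cA dA]; first exact: cvg_id.
by rewrite setIT; exact: (atlas_compat cA dA).
Qed.

(** In product charts the projection reads as a transition map of [SM] precomposed with [lsubmx]. *)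
Lemma smooth_fst n m (M N : topologicalType) (SM : manifold R n M)
    (SN : manifold R m N) : smooth (product_manifold SM SN) SM fst.
Proof.
split=> [x _|_ e [c cA [d dA <-]] eA k]; first exact: cvg_fst.
apply: Ck_on_subset (@Ck_on_lsubmx R n m _ k _ _ (atlas_compat cA eA k)).
by move=> _ [[x y] [[[/= cx dy] _] /= ex] <-]; exists x; rewrite //= row_mxKl.
Qed.

Lemma smooth_snd n m (M N : topologicalType) (SM : manifold R n M)
    (SN : manifold R m N) : smooth (product_manifold SM SN) SN snd.
Proof.
split=> [x _|_ e [c cA [d dA <-]] eA k]; first exact: cvg_snd.
apply: Ck_on_subset (@Ck_on_rsubmx R n m _ k _ _ (atlas_compat dA eA k)).
by move=> _ [[x y] [[[/= cx dy] _] /= ey] <-]; exists y; rewrite //= row_mxKr.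
Qed.

Lemma smooth_pair n m p (M N K : topologicalType) (SM : manifold R n M)
    (SN : manifold R m N) (SK : manifold R p K) (f : M -> N) (g : M -> K) :
  smooth SM SN f -> smooth SM SK g ->
  smooth SM (product_manifold SN SK) (fun x => (f x, g x)).
Proof.
move=> [fc fC] [gc gC].
split=> [x _|c _ cA [d dA [e eA <-]] k].
  by apply: pair_continuous; [exact: fc|exact: gc].
apply: Ck_on_row_mx.
- rewrite -setIA; apply: chart_im_open_sub.
  apply: open_setI_preimage; first exact: openT.
    by move=> x _; apply: pair_continuous; [exact: fc|exact: gc].
  by apply: open_setX; exact: chart_dom_open.
- by apply: Ck_on_subset (fC c d cA dA k) => _ [x [cx [/= dx _]] <-]; exists x.
- by apply: Ck_on_subset (gC c e cA eA k) => _ [x [cx [/= _ ex]] <-]; exists x.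
Qed.

Lemma local_diffeomorphism_smooth n m (M N : topologicalType)
    (SM : manifold R n M) (SN : manifold R m N) (f : M -> N) :
  local_diffeomorphism SM SN f -> smooth SM SN f.
Proof.
by move=> fd; apply/smooth_atP => x; have [U [g [[oU Ux] _ _ fC _]]] := fd x; exists U.
Qed.

Lemma local_diffeomorphism_section n m (M N : topologicalType)
    (SM : manifold R n M) (SN : manifold R m N) (f : M -> N) x :
  local_diffeomorphism SM SN f -> exists g : N -> M,
    [/\ g (f x) = x, \forall y \near f x, f (g y) = y & smooth_at SN SM (f x) g].
Proof.
move=> fd; have [U [g [[oU Ux] ofU gK _ gC]]] := fd x; exists g; split.
- exact: gK.
- apply: (@filterS _ (nbhs (f x)) _ (f @` U)).
    by move=> _ [u Uu <-]; rewrite gK.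
  by apply: open_nbhs_nbhs; split=> //; exists x.
- by exists (f @` U); split=> //; exists x.
Qed.

End smooth_maps.

(** * Lifting sections to equivariant maps, and descending back *)

Section correspondence.
Local Open Scope group_scope.
Context {R : realType} {G : groupType} {n m : nat} {X F : topologicalType}.
Context {SX : manifold R n X} {SF : manifold R m F}.
Context {P : principal_bundle G SX} (E : associated_bundle SF P).
Implicit Types (s : base_space P -> total_space E) (phi : X -> F).

Local Notation pi := (base_proj P).
Local Notation q := (total_proj E).
Local Notation "x .* g" := (pb_act P x g) (at level 40).

Lemma base_proj_surj b : exists x, pi x = b.
Proof. by exists (repr b); rewrite /base_proj/orbit_proj reprK. Qed.

Lemma base_projP x y : pi x = pi y <-> exists g, y = x .* g.
Proof. exact: orbit_projP. Qed.

Lemma total_projP x y x' y' : q (x, y) = q (x', y') <->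
  exists g, x' = x .* g /\ y' = ab_act E g^-1 y.
Proof.
split=> [/orbit_projP[g [-> ->]]|[g [-> ->]]]; first by exists g.
by apply/orbit_projP; exists g.
Qed.

Lemma total_proj_surj e : exists p, q p = e.
Proof. by exists (repr e); rewrite /total_proj/orbit_proj reprK. Qed.

(** Taking [u = x] gives freeness at [x]; letting [u] vary forces a group element to be trivial
    throughout a neighbourhood, as [smooth_lift] requires. *)
Lemma pb_act_free_nbhs (x : X) : exists2 U, nbhs x U &
  forall u g, U u -> U (u .* g) -> g = 1.
Proof.
have [U nU Ufree] := pb_act_free P x; exists U => // u g Uu Uug.
apply: contrapT => /eqP g1.
suff : set0 (u .* g) by [].
by rewrite -(Ufree g g1); split=> //; exists u.
Qed.

Lemma pb_act_fixed x g : x = x .* g -> g = 1.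
Proof.
have [U /nbhs_singleton Ux Ufree] := pb_act_free_nbhs x => xg.
by apply: (Ufree x) => //; rewrite -xg.
Qed.

Lemma total_proj_inj x y y' : q (x, y) = q (x, y') -> y = y'.
Proof.
by move=> /total_projP[g [/pb_act_fixed -> ->]]; rewrite invg1 lact1.
Qed.

Lemma cross_section_lift s x : cross_section E s -> exists y, s (pi x) = q (x, y).
Proof.
move=> sE; have [[x' y'] sx] := total_proj_surj (s (pi x)).
have : pi x' = pi x by rewrite -(bundle_projE E x' y') sx sE.
(* Translating the representative [(x', y')] by [g] brings its first component to [x]. *)
move=> /base_projP[g xE]; exists (ab_act E g^-1 y').
by rewrite -sx; apply/total_projP; exists g.
Qed.

(** Since [pi (x .* g) = pi x], the pairs of [x .* g] with [phi (x .* g)] and with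
    [ab_act E g^-1 (phi x)] represent the same point, and [total_proj_inj] compares them. *)
Lemma equivariant_lift s phi : (forall x, s (pi x) = q (x, phi x)) ->
  equivariant E phi.
Proof.
move=> sE x g; apply: (@total_proj_inj (x .* g)); rewrite -sE.
have <- : pi x = pi (x .* g) by apply/base_projP; exists g.
by rewrite sE; apply/total_projP; exists g.
Qed.

(* A local inverse [r] of [q] gives [h := r \o s \o pi] with
   [q (h x) = q (x, phi x)] and [h x0 = (x0, phi x0)]; the group element
   relating [h x] to [(x, phi x)] is trivial near [x0] because both first
   components stay in a neighbourhood disjoint from its translates. *)
Lemma smooth_lift s phi : smooth (pb_base P) (ab_total E) s ->
  (forall x, s (pi x) = q (x, phi x)) -> smooth SX SF phi.
Proof.
move=> /smooth_atP sC sE; apply/smooth_atP => x0.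
have /smooth_atP piC := local_diffeomorphism_smooth (pb_proj_local_diffeo P).
have [r [rK qr rC]] :=
  local_diffeomorphism_section (x0, phi x0) (ab_proj_local_diffeo E).
have spiC : smooth_at SX (ab_total E) x0 (s \o pi).
  exact: smooth_at_comp (piC x0) (sC _).
rewrite -[orbit_proj _ _]/(q (x0, phi x0)) -sE in rK qr rC.
have hC : smooth_at SX (product_manifold SX SF) x0 (r \o (s \o pi)).
  exact: smooth_at_comp spiC rC.
have /smooth_atP sndC := smooth_snd SX SF.
apply: (@smooth_at_near_eq _ _ _ _ _ _ _ _ (snd \o (r \o (s \o pi)))); last first.
  exact: smooth_at_comp hC (sndC _).
have qh : \forall x \near x0, q (r (s (pi x))) = s (pi x).
  exact: (smooth_at_continuous spiC) qr.
have /smooth_atP fstC := smooth_fst SX SF.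
have h1c := smooth_at_continuous (smooth_at_comp hC (fstC _)).
have [U nU Ufree] := pb_act_free_nbhs x0.
have nhU : \forall x \near x0, U (r (s (pi x))).1.
  by apply: h1c; rewrite /= rK.
apply: filterS3 qh nhU nU => x qhx Uhx Ux.
rewrite /=; case: (r (s (pi x))) qhx Uhx => x' y'.
rewrite sE => /total_projP[g [xE ->]] Ux'.
have -> : g = 1 by apply: (Ufree x') => //; rewrite -xE.
by rewrite invg1 lact1.
Qed.

Lemma smooth_descend s phi : smooth SX SF phi ->
  (forall x, s (pi x) = q (x, phi x)) -> smooth (pb_base P) (ab_total E) s.
Proof.
move=> phiC sE; apply/smooth_atP => b; have [x <-] := base_proj_surj b.
have [r [rK pir rC]] :=
  local_diffeomorphism_section x (pb_proj_local_diffeo P).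
have /smooth_atP qC := local_diffeomorphism_smooth (ab_proj_local_diffeo E).
have /smooth_atP grC := smooth_pair (smooth_id SX) phiC.
have qgC : smooth_at SX (ab_total E) (r (pi x)) (q \o (fun x => (x, phi x))).
  exact: smooth_at_comp (grC _) (qC _).
apply: (@smooth_at_near_eq _ _ _ _ _ _ _ _
  ((q \o (fun x => (x, phi x))) \o r)); last exact: smooth_at_comp rC qgC.
by apply: filterS pir => c piE; rewrite /= -sE; congr s.
Qed.

(** Equivariance makes [q (x, phi x)] constant on orbits, so evaluating it at the chosen
    representative [repr b] loses nothing. *)
Lemma equivariant_descend phi : equivariant E phi ->
  exists s, forall x, s (pi x) = q (x, phi x).
Proof.
move=> phiE; exists (fun b => q (repr b, phi (repr b))) => x.
have /base_projP[g xE] : pi (repr (pi x)) = pi x.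
  by rewrite /base_proj/orbit_proj reprK.
by apply/total_projP; exists g; rewrite -phiE -xE.
Qed.

Lemma cross_section_of_lift s phi : (forall x, s (pi x) = q (x, phi x)) ->
  cross_section E s.
Proof.
by move=> sE b; have [x <-] := base_proj_surj b; rewrite sE bundle_projE.
Qed.

End correspondence.

(** The formula in the second conjunct determines [Theta] on smooth cross sections, by
    [total_proj_inj]. *)
Theorem theorem6p3 (R : realType) (G : groupType) (n m : nat)
    (X F : topologicalType) (SX : manifold R n X) (SF : manifold R m F)
    (P : principal_bundle G SX) (E : associated_bundle SF P) :
  exists Theta : (base_space P -> total_space E) -> (X -> F),
    set_bij (smooth_cross_sections E) (smooth_equivariant_maps E) Theta /\
    (forall s, smooth_cross_sections E s ->
       forall x : X, s (base_proj P x) = total_proj E (x, Theta s x)).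
Proof.
have lift1 s x : exists y, cross_section E s ->
    s (base_proj P x) = total_proj E (x, y).
  have [sE|] := pselect (cross_section E s).
    by have [y sx] := cross_section_lift x sE; exists y.
  (* A default value: [lift] is total, so a point of [F] is also required when [s] is not a cross
     section. *)
  by exists (repr (s (base_proj P x))).2.
pose lift s := projT1 (choice (lift1 s)).
have liftE s : cross_section E s ->
    forall x, s (base_proj P x) = total_proj E (x, lift s x).
  by move=> sE x; exact: (projT2 (choice (lift1 s)) x sE).
exists lift; split; last by move=> s [_ sE]; exact: liftE.
split.
- move=> s [sC sE]; split; first exact: smooth_lift sC (liftE s sE).
  exact: equivariant_lift (liftE s sE).
(* Injectivity: a section is recovered from its lift because [pi] is surjective. *)
- move=> s t; rewrite !inE => -[_ sE] [_ tE] st; apply/funext => b.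
  have [x <-] := base_proj_surj b.
  by rewrite (liftE _ sE) (liftE _ tE) st.
- move=> phi [phiC phiE]; have [s sE] := equivariant_descend phiE.
  have sS := cross_section_of_lift sE.
  exists s; first by split=> //; exact: smooth_descend phiC sE.
  (* Paired with [x], both [lift s x] and [phi x] represent [s (pi x)], so they coincide. *)
  by apply/funext => x; apply: (@total_proj_inj _ _ _ _ _ _ _ _ _ E x); rewrite -liftE.
Qed.
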